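(* Every set of three positive integers is the score set of some oriented bipartite graph. That is, for all positive integers $a_1<a_2<a_3$ there is an oriented bipartite graph with score set $\{a_1,a_2,a_3\}$.
   Context: An oriented bipartite graph $D(U,V)$ is obtained by assigning a direction to each edge of a simple bipartite graph with parts $U=\{u_1,\dots,u_m\}$ and $V=\{v_1,\dots,v_n\}$. For a vertex $x$, let $d_x^+$ and $d_x^-$ denote its outdegree and indegree. The score of $u\in U$ is $a_u=n+d_u^+-d_u^-$ and the score of $v\in V$ is $b_v=m+d_v^+-d_v^-$. The score set of $D(U,V)$ is the set of distinct scores of all its vertices. *)

(* Defs.v *)
From HB Require Import structures.
From mathcomp Require Import all_boot all_order all_algebra.

Set Implicit Arguments.
Unset Strict Implicit.
Unset Printing Implicit Defensive.

Import GRing.Theory Num.Theory.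
Local Open Scope ring_scope.

(* D(U, V) with U = 'I_m and V = 'I_n; the vertex set is the disjoint sum.
   Asymmetry of arc says that each edge of the underlying simple graph gets
   exactly one direction; not every pair (u, v) has to be an edge. *)
Record oriented_bigraph (m n : nat) := OrientedBigraph {
  arc : rel ('I_m + 'I_n);
  arc_UU : forall u u' : 'I_m, ~~ arc (inl u) (inl u');
  arc_VV : forall v v' : 'I_n, ~~ arc (inr v) (inr v');
  arc_asym : forall x y, arc x y -> ~~ arc y x
}.

Section Scores.
Variables (m n : nat) (D : oriented_bigraph m n).

Definition outdeg (x : 'I_m + 'I_n) : nat := #|[set y | arc D x y]|.

Definition indeg (x : 'I_m + 'I_n) : nat := #|[set y | arc D y x]|.

Definition opposite_size (x : 'I_m + 'I_n) : nat :=
  match x with inl _ => n | inr _ => m end.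

Definition score (x : 'I_m + 'I_n) : int :=
  (opposite_size x)%:Z + (outdeg x)%:Z - (indeg x)%:Z.

(* A duplicate-free list, to be used through its membership predicate. *)
Definition score_set : seq int := undup (codom score).

End Scores.

(* Main.v *)
(** Put only two scores [x], [y] on [U] ([p] and [q] times) and a single score
    [z] on [V].  Encoding the arcs between [u] and [v] by a multiplicity 0, 1
    or 2 (arc into [u], no arc, arc out of [u]), the score of [u] is its row
    sum.  Dealing the units of the successive rows to the [n] columns
    cyclically makes all column sums equal, so such a graph exists as soon as
    [x, y <= 2 * n] and [p * x + q * y + n * z = 2 * (p + q) * n].  This
    equation is solved by
    - [p = 1], [2 * n = y + 1] when [y] is odd, [x < y] and [2 <= z];
    - [p = 2], [2 * n = y + 2] when [y] and [z] are even, [x < y] and [4 <= z];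
    and one of these applies to [(a1, a2, a3)] or to [(a1, a3, a2)]. *)
Require Import Defs.
From mathcomp Require Import all_boot all_order all_algebra.
From mathcomp Require Import zify.
Import GRing.Theory Num.Theory.
Local Open Scope ring_scope.

Lemma sum1_ord n : (\sum_(i < n) 1 = n)%N.
Proof. by rewrite sum1_card card_ord. Qed.

Section MultiplicityGraph.
Variables (m n : nat) (X : 'I_m -> 'I_n -> nat).

Definition mult_arc (s t : 'I_m + 'I_n) : bool :=
  match s, t with
  | inl u, inr v => X u v == 2%N
  | inr v, inl u => X u v == 0%N
  | _, _ => false
  end.

Lemma mult_arc_asym s t : mult_arc s t -> ~~ mult_arc t s.
Proof. by case: s t => [u|v] [u'|v'] //= /eqP ->. Qed.

Definition mult_graph : oriented_bigraph m n :=
  @OrientedBigraph m n mult_arc (fun _ _ => isT) (fun _ _ => isT) mult_arc_asym.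

Lemma card_sum_set (P : pred ('I_m + 'I_n)) :
  #|[set s | P s]| = (\sum_i P (inl i) + \sum_j P (inr j))%N.
Proof. by rewrite cardsE -sum1_card big_mkcond big_sumType. Qed.

Hypothesis X_le2 : forall u v, (X u v <= 2)%N.

(** Entrywise, [1 + [k = 2] - [k = 0] = k] for [k <= 2]; seen from [V] the two brackets trade signs,
    which gives [2 - k]. *)
Lemma score_mult_graph_inl u : score mult_graph (inl u) = (\sum_v X u v)%N%:Z.
Proof.
rewrite /score /outdeg /indeg !card_sum_set /= !big1_eq !add0n.
apply/eqP; rewrite subr_eq -!PoszD eqz_nat -{1}(sum1_ord n) -!big_split /=.
by apply/eqP/eq_bigr => v _; case: (X u v) (X_le2 u v) => [|[|[|]]].
Qed.

Lemma score_mult_graph_inr v :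
  score mult_graph (inr v) = (2 * m)%N%:Z - (\sum_u X u v)%N%:Z.
Proof.
rewrite /score /outdeg /indeg !card_sum_set /= !big1_eq !addn0.
apply/eqP; rewrite subr_eq addrAC eq_sym subr_eq eq_sym -!PoszD eqz_nat mul2n.
rewrite -addnn -!addnA eqn_add2l eq_sym -{1}(sum1_ord m) -!big_split /=.
by apply/eqP/eq_bigr => u _; case: (X u v) (X_le2 u v) => [|[|[|]]].
Qed.

End MultiplicityGraph.

(** A case of Hermite's identity: from [s] to [s + 1] the summand [s %/ n] is replaced by
    [(s + n) %/ n], which is one larger. *)
Lemma sum_divn_shift (n s : nat) : (0 < n)%N ->
  (\sum_(j < n) (s + j) %/ n = s)%N.
Proof.
case: n => // n _; elim: s => [|s IHs].
  by rewrite big1 // => j _; rewrite add0n divn_small.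
rewrite big_ord_recr /= addSnnS divnDr // divnn addn1 -[in RHS]IHs.
rewrite big_ord_recl /= addn0 addnS addnC; congr (_ + _).+1.
by apply: eq_bigr => j _; rewrite addSnnS.
Qed.

Section RoundRobin.
Variables (m n : nat) (r : nat -> nat).

Definition row_start (i : nat) : nat := \sum_(k < i) r k.

(* Unit number [k] goes to the column [j] with [k + j + 1] divisible by [n], so
   column [j] has received [(s + j) %/ n] of the first [s] units. *)
Definition round_robin (i : 'I_m) (j : 'I_n) : nat :=
  (row_start i.+1 + j) %/ n - (row_start i + j) %/ n.

Lemma row_startS i : row_start i.+1 = (row_start i + r i)%N.
Proof. exact: big_ord_recr. Qed.

Lemma leq_row_start_div i j :
  ((row_start i + j) %/ n <= (row_start i.+1 + j) %/ n)%N.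
Proof. by rewrite leq_div2r // leq_add2r row_startS leq_addr. Qed.

(** A row of at most [2 * n] units goes at most twice round the [n] columns. *)
Lemma round_robin_le2 : (0 < n)%N -> (forall i : 'I_m, r i <= 2 * n)%N ->
  forall i j, (round_robin i j <= 2)%N.
Proof.
move=> n_gt0 r_le i j; rewrite leq_subLR row_startS [leqRHS]addnC -divnMDl //.
by rewrite leq_div2r // addnAC addnC leq_add2r.
Qed.

Lemma row_sum_round_robin (i : 'I_m) : (0 < n)%N ->
  (\sum_j round_robin i j = r i)%N.
Proof.
move=> n_gt0; rewrite sumnB => [|j _]; last exact: leq_row_start_div.
by rewrite !sum_divn_shift // row_startS addKn.
Qed.

(** The sum telescopes to [(n * t + j) %/ n - j %/ n], and [j < n]. *)
Lemma col_sum_round_robin (t : nat) (j : 'I_n) : row_start m = (n * t)%N ->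
  (\sum_i round_robin i j = t)%N.
Proof.
have n_gt0 : (0 < n)%N := leq_ltn_trans (leq0n j) (ltn_ord j).
move=> total; rewrite -(big_mkord xpredT (fun i =>
  (row_start i.+1 + j) %/ n - (row_start i + j) %/ n)%N).
rewrite telescope_sumn; last first.
  by apply: homo_leq => // [? ? ?|i]; [exact: leq_trans|exact: leq_row_start_div].
by rewrite total /row_start big_ord0 mulnC divnMDl // divn_small // subn0 addn0.
Qed.

End RoundRobin.

Lemma score_set_two_one (x y z p q n : nat) :
    (0 < p)%N -> (0 < q)%N -> (0 < n)%N -> (x <= 2 * n)%N -> (y <= 2 * n)%N ->
    (p * x + q * y + n * z = 2 * (p + q) * n)%N ->
  exists (m n : nat) (D : oriented_bigraph m n),
    score_set D =i [:: x%:Z; y%:Z; z%:Z].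
Proof.
move=> p_gt0 q_gt0 n_gt0 x_le y_le total.
pose r i := if (i < p)%N then x else y.
have r_le (i : 'I_(p + q)) : (r i <= 2 * n)%N by rewrite /r; case: ifP.
(* Each column sum will be [2 * (p + q) - z]; this bound makes the truncated subtraction exact. *)
have z_le : (z <= 2 * (p + q))%N.
  by rewrite -(leq_pmul2l n_gt0) [leqRHS]mulnC -total leq_addl.
have row_total : row_start r (p + q) = (n * (2 * (p + q) - z))%N.
  rewrite mulnBr [in RHS](mulnC n (2 * _)) -total addnK.
  rewrite /row_start big_split_ord /= /r.
  congr (_ + _)%N.
    rewrite -[in RHS](card_ord p) -sum_nat_const.
    by apply: eq_bigr => i _; rewrite ltn_ord.
  rewrite -[in RHS](card_ord q) -sum_nat_const.
  by apply: eq_bigr => i _; rewrite ltnNge leq_addr.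
pose D := mult_graph (p + q) n (round_robin (p + q) n r).
have X_le2 := round_robin_le2 (p + q) n r n_gt0 r_le.
have scoreU u : score D (inl u) = (r u)%:Z.
  by rewrite score_mult_graph_inl // row_sum_round_robin.
have scoreV v : score D (inr v) = z%:Z.
  rewrite score_mult_graph_inr // (col_sum_round_robin _ _ _ _ _ row_total).
  by rewrite -subzn // opprB addrC subrK.
exists (p + q)%N, n, D => s; rewrite mem_undup !inE.
apply/codomP/idP => [[[u|v] ->]|/or3P[] /eqP ->].
- by rewrite scoreU /r; case: ifP; rewrite eqxx ?orbT.
- by rewrite scoreV eqxx !orbT.
- have u_lt : (0 < p + q)%N by rewrite addn_gt0 p_gt0.
  by exists (inl (Ordinal u_lt)); rewrite scoreU /r /= p_gt0.
- have u_lt : (p < p + q)%N by rewrite -ltn_subLR ?subnn.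
  by exists (inl (Ordinal u_lt)); rewrite scoreU /r /= ltnn.
- by exists (inr (Ordinal n_gt0)); rewrite scoreV.
Qed.

Lemma score_set_odd (x y z : nat) :
    (0 < x)%N -> (x < y)%N -> (1 < z)%N -> odd y ->
  exists (m n : nat) (D : oriented_bigraph m n),
    score_set D =i [:: x%:Z; y%:Z; z%:Z].
Proof.
move=> x_gt0 x_lt z_gt1 y_odd.
pose n := y./2.+1; have y_eq : y = (2 * n - 1)%N by rewrite /n; lia.
(* Since [2 * n - y = 1], the equation determines [q]; [z >= 2] gives [q >= x > 0]. *)
by apply: (score_set_two_one x y z 1 (n * z - (2 * n - x)) n); nia.
Qed.

Lemma score_set_even (x y z : nat) :
    (0 < x)%N -> (x < y)%N -> (3 < z)%N -> ~~ odd y -> ~~ odd z ->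
  exists (m n : nat) (D : oriented_bigraph m n),
    score_set D =i [:: x%:Z; y%:Z; z%:Z].
Proof.
move=> x_gt0 x_lt z_gt3 y_even z_even.
pose n := y./2.+1; have y_eq : y = (2 * n - 2)%N by rewrite /n; lia.
pose k := z./2; have z_eq : z = (2 * k)%N by rewrite /k; lia.
(* Now [2 * n - y = 2], so [q] comes from halving the equation; [k >= 2] gives [q >= x > 0]. *)
by apply: (score_set_two_one x y z 2 (n * k - (2 * n - x)) n); nia.
Qed.

Theorem theorem2p2 (a1 a2 a3 : int) (h1 : 0 < a1) (h12 : a1 < a2)
  (h23 : a2 < a3) :
  exists (m n : nat) (D : oriented_bigraph m n),
    score_set D =i [:: a1; a2; a3].
Proof.
case: a1 a2 a3 h1 h12 h23 => [x|//] [y|//] [z|//].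
rewrite !ltz_nat => x_gt0 xy yz.
have [y_odd|y_even] := boolP (odd y); first by apply: score_set_odd; lia.
(* As [y] is even and positive, [y >= 2]: this serves the exchange of [y] and [z] for odd [z], and
   forces [z >= 4] for even [z]. *)
have [z_odd|z_even] := boolP (odd z); last by apply: score_set_even; lia.
have [m [n [D scoreD]]] : exists (m n : nat) (D : oriented_bigraph m n),
    score_set D =i [:: x%:Z; z%:Z; y%:Z] by apply: score_set_odd; lia.
by exists m, n, D => s; rewrite scoreD !inE; congr (_ || _); rewrite orbC.
Qed.
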